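(* Let $M$ be a partially ordered monoid with a family of null sequences $Z(M)$ such that the pair $(M,Z(M))$ satisfies the Weierstrass property, let $X$ be a nonempty set, and let $(X,d_{X,M},Z(M))$ be a $\mathcal{W}$-complete equipped dislocated $M$-distance space. Let $f\colon X\to X$ be weakly orbitally continuous. Assume that mappings $\phi\colon X\to M_+$ and $\eta\colon M_+\to M_+$ are such that for all $x\in X$ $$\eta(d_{X,M}(x,f(x)))+\phi(f(x))\le\phi(x),$$ that $\eta$ is semi-additive (i.e. $\eta(a+b)\le\eta(a)+\eta(b)$ for all $a,b\in M_+$), and that for each $A\subset M_+$, if $\eta(A)$ is bounded, then $A$ is bounded. Then $f$ has a fixed point.
   Context: A partially ordered monoid is a monoid $(M,+,\theta_M)$ (associative operation $+$, neutral element $\theta_M$; not assumed commutative) with a partial order $\le$ such that $x_1\le y_1$, $x_2\le y_2$ imply $x_1+x_2\le y_1+y_2$, and $M_+:=\{x\in M:\theta_M\le x\}\ne\{\theta_M\}$. A set $N\subset M_+$ is bounded if there is $m\in M$ with $n\le m$ for all $n\in N$. A family of null sequences $Z(M)$ is a family of sequences of elements of $M_+$ such that: (1) the constant sequence $\{\theta_M\}$ is in $Z(M)$, and if $x\in M_+$ and the constant sequence $\{x\}$ is in $Z(M)$ then $x=\theta_M$; (2) $\{x_n\},\{y_n\}\in Z(M)$ implies $\{x_n+y_n\}\in Z(M)$; (3) if $\{x_n\}\in Z(M)$ and $\theta_M\le y_n\le x_n$ for all $n$, then $\{y_n\}\in Z(M)$; (4) each subsequence of a sequence in $Z(M)$ is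 in $Z(M)$. $\mathcal{CS}$ denotes the set of sequences $\{x_n\}$ in $M_+$ whose series is a Cauchy series, i.e. for all increasing sequences of natural numbers $\{n_k\},\{m_k\}$ with $m_k\ge n_k$ for all $k$ one has $\{\sum_{s=n_k}^{m_k}x_s\}_k\in Z(M)$. The pair $(M,Z(M))$ satisfies the Weierstrass property if for every sequence $\{\alpha_n\}\subset M_+$ whose sequence of partial sums $\{\sum_{k=1}^n\alpha_k\}$ is bounded, one has $\{\alpha_n\}\in\mathcal{CS}$. A dislocated $M$-valued distance on a set $X$ is a mapping $d_{X,M}\colon X\times X\to M_+$ with $d_{X,M}(x,y)=d_{X,M}(y,x)$ for all $x,y$ and such that $d_{X,M}(x,y)=\theta_M$ implies $x=y$. Together with a chosen family $Z(M)$ it forms an equipped dislocated $M$-distance space $(X,d_{X,M},Z(M))$. A sequence $\{x_n\}\subset X$ converges to $x\in X$ ($x_n\to x$) if $\{d_{X,M}(x_n,x)\}\in Z(M)$. $\mathcal{CW}$ is the family of sequences $\{x_n\}\subset X$ with $\{d_{X,M}(x_n,x_{n+1})\}\in\mathcal{CS}$; the space is $\mathcal{W}$-complete if each sequence in $\mathcal{CW}$ converges to an element of $X$. A function $f\colon X\to X$ is weakly orbitally continuous if for $x,a\in X$, $f^n(x)\to a$ as $n\to\infty$ implies $f(a)=a$, where $f^n$ is the $n$-th iterate of $f$. *)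

(* Defs.v *)
From HB Require Import structures.
From mathcomp Require Import all_boot all_order.
From mathcomp Require Import boolp classical_sets functions.

Set Implicit Arguments.
Unset Strict Implicit.
Unset Printing Implicit Defensive.

Local Open Scope order_scope.
Local Open Scope classical_set_scope.

(* MathComp's additive monoids ([nmodType]) are commutative, so the monoid   *)
(* here is a (multiplicative) [monoidType], for which this scope provides    *)
(* additive notations. Sums are taken in increasing order of the index.      *)
Declare Scope pomonoid_scope.
Delimit Scope pomonoid_scope with P.
Local Open Scope pomonoid_scope.

Notation "0" := (@monoid.one _) : pomonoid_scope.
Notation "x + y" := (@monoid.mul _ x y) : pomonoid_scope.
Notation "\sum_ ( m <= i < n ) F" :=
  (\big[@monoid.mul _/@monoid.one _]_(m <= i < n) F) : pomonoid_scope.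

HB.mixin Record isPOMonoid d M & Order.POrder d M & monoid.Monoid M := {
  leD2 : forall x1 y1 x2 y2 : M,
    x1 <= y1 -> x2 <= y2 -> x1 + x2 <= y1 + y2;
  nonneg_neq0 : [set x : M | (0 : M) <= x] <> [set 0]
}.

#[short(type="poMonoidType")]
HB.structure Definition POMonoid d :=
  { M of Order.POrder d M & monoid.Monoid M & isPOMonoid d M }.

Section POMonoidDefs.
Context {d : Order.disp_t} {M : poMonoidType d}.

Definition Mplus : set M := [set x | 0 <= x].

(* Strict monotonicity is essential: with merely nondecreasing index         *)
(* sequences only the zero sequence could have a Cauchy series.              *)
Definition increasing (s : nat -> nat) : Prop := {homo s : i j / (i < j)%N}.

Record null_family (Z : set (nat -> M)) : Prop := NullFamily {
  null_Mplus : forall x, Z x -> forall n, Mplus (x n);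
  null_zero : Z (fun=> 0);
  null_const : forall x, Mplus x -> Z (fun=> x) -> x = 0;
  null_add : forall x y, Z x -> Z y -> Z (fun n => x n + y n);
  null_le : forall x y, Z x -> (forall n, 0 <= y n <= x n) -> Z y;
  null_subseq : forall x s, Z x -> increasing s -> Z (x \o s)
}.

Definition cauchy_series (Z : set (nat -> M)) : set (nat -> M) :=
  [set x | (forall n, Mplus (x n)) /\
    forall n m : nat -> nat, increasing n -> increasing m ->
      (forall k, (n k <= m k)%N) ->
      Z (fun k => \sum_(n k <= s < (m k).+1) x s)].

Definition weierstrass (Z : set (nat -> M)) : Prop :=
  forall x : nat -> M, (forall n, Mplus (x n)) ->
    has_ubound (range (fun n => \sum_(0 <= k < n.+1) x k)) ->
    cauchy_series Z x.

Section Distance.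
Context {X : Type}.

Record dislocated_distance (D : X -> X -> M) : Prop := DislocatedDistance {
  dist_Mplus : forall x y, Mplus (D x y);
  dist_sym : forall x y, D x y = D y x;
  dist_eq : forall x y, D x y = 0 -> x = y
}.

Variables (D : X -> X -> M) (Z : set (nat -> M)).

Definition converges (x : nat -> X) (a : X) : Prop := Z (fun n => D (x n) a).

Definition CW : set (nat -> X) :=
  [set x | cauchy_series Z (fun n => D (x n) (x n.+1))].

Definition W_complete : Prop := forall x, CW x -> exists a, converges x a.

Definition weakly_orbitally_continuous (f : X -> X) : Prop :=
  forall x a, converges (fun n => iter n f x) a -> f a = a.

End Distance.
End POMonoidDefs.

Arguments Mplus {d} M.

(* Main.v *)
(** Along an orbit the hypothesis telescopes to [eta S_n + phi (f^(n+1) x) <= phi x],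
    where [S_n] is the [n]-th partial sum of the consecutive distances; hence the
    [eta S_n], and so the [S_n], are bounded, the orbit is in [CW], and its limit
    is a fixed point. *)

Require Import Defs.
From mathcomp Require Import all_boot all_order.
From mathcomp Require Import boolp classical_sets functions.

Local Open Scope order_scope.
Local Open Scope classical_set_scope.
Local Open Scope pomonoid_scope.

Import Order.POrderTheory.

Section POMonoidTheory.
Context {d : Order.disp_t} {M : poMonoidType d}.
Implicit Types x y : M.

Lemma Mplus_add x y : Mplus M x -> Mplus M y -> Mplus M (x + y).
Proof. by move=> x0 y0; rewrite /Mplus /= -[X in X <= _]monoid.mul1g; exact: leD2. Qed.

Lemma le_addr_Mplus x y : Mplus M y -> x <= x + y.
Proof. by move=> y0; rewrite -[X in X <= _]monoid.mulg1; exact: leD2. Qed.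

Lemma Mplus_sum (u : nat -> M) m n :
  (forall k, Mplus M (u k)) -> Mplus M (\sum_(m <= k < n) u k).
Proof.
move=> u0; elim/big_ind: _ => //; first exact: lexx.
exact: Mplus_add.
Qed.

(* The sums are nonempty because [eta 0] need not be [0]. *)
Lemma semiadditive_telescope (eta : M -> M) (u v : nat -> M) n :
  (forall k, Mplus M (u k)) ->
  (forall a b, Mplus M a -> Mplus M b -> eta (a + b) <= eta a + eta b) ->
  (forall k, eta (u k) + v k.+1 <= v k) ->
  eta (\sum_(0 <= k < n.+1) u k) + v n.+1 <= v 0%N.
Proof.
move=> u0 etaD uv; elim: n => [|n IHn]; first by rewrite big_nat1.
rewrite big_nat_recr //=; apply: le_trans IHn.
(* The monoid need not be commutative: the new summand enters on the right, so after [etaD] the term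
   [eta (u n.+1)] stands next to [v n.+2], where [uv] absorbs both into [v n.+1]. *)
apply: (le_trans _ (leD2 _ _ _ _ (lexx _) (uv n.+1))).
rewrite monoid.mulgA; apply: leD2 => //.
by apply: etaD => //; exact: Mplus_sum.
Qed.

End POMonoidTheory.

Theorem theorem2 (d : Order.disp_t) (M : poMonoidType d)
    (Z : set (nat -> M)) (X : Type) (D : X -> X -> M)
    (f : X -> X) (phi : X -> M) (eta : M -> M) :
  null_family Z ->
  weierstrass Z ->
  inhabited X ->
  dislocated_distance D ->
  W_complete D Z ->
  weakly_orbitally_continuous D Z f ->
  (forall x, Mplus M (phi x)) ->
  (forall a, Mplus M a -> Mplus M (eta a)) ->
  (forall x, eta (D x (f x)) + phi (f x) <= phi x) ->
  (forall a b, Mplus M a -> Mplus M b -> eta (a + b) <= eta a + eta b) ->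
  (forall A : set M, A `<=` Mplus M ->
    has_ubound (eta @` A) -> has_ubound A) ->
  exists x, f x = x.
Proof.
move=> _ WZ [x0] HD WD fc phi0 _ etaphi etaD eta_bd.
pose x n := iter n f x0; pose u n := D (x n) (x n.+1).
have u0 n : Mplus M (u n) by exact: dist_Mplus HD _ _.
have sum_bd : has_ubound (range (fun n => \sum_(0 <= k < n.+1) u k)).
  apply: eta_bd => [_ [n _ <-]|]; first exact: Mplus_sum.
  exists (phi x0) => _ [_ [n _ <-] <-].
  (* With no subtraction available, the nonnegative term [phi (x n.+1)] is added on the right to
     reach the telescoped bound. *)
  apply: le_trans (le_addr_Mplus _ _ (phi0 (x n.+1))) _.
  apply: (semiadditive_telescope eta u (phi \o x) n u0 etaD) => k.
  exact: etaphi.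
(* By the choice of [u], a Cauchy series for [u] is literally membership of the orbit [x] in
   [CW]. *)
have [a xa] := WD x (WZ u u0 sum_bd).
by exists a; exact: fc xa.
Qed.
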